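(* Let $R$ be a finite local (commutative) ring. Then \[ |\mathcal{P}(R[\alpha])|=|\mathcal{F}(R)|\cdot|\mathcal{P}(R)|\cdot|St_\alpha(R)|. \]
   Context: All rings are commutative with $1$. For a ring $R$, the ring of dual numbers over $R$ is $R[\alpha]=R[x]/(x^2)$, where $\alpha=x+(x^2)$; so every element is uniquely $a+b\alpha$ with $a,b\in R$, $\alpha^2=0$, and $R$ is a subring of $R[\alpha]$ via $a\mapsto a+0\alpha$. For a finite commutative ring $A$, a polynomial function on $A$ is a function $A\to A$ of the form $a\mapsto f(a)$ for some $f\in A[x]$; $\mathcal{F}(A)$ is the set of polynomial functions on $A$, and $\mathcal{P}(A)$ is the group (under composition) of bijective polynomial functions on $A$. $St_\alpha(R)=\{F\in\mathcal{P}(R[\alpha])\mid F(a)=a\text{ for every }a\in R\}$ is the pointwise stabilizer of $R$ in $\mathcal{P}(R[\alpha])$. *)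

(* Defs.v *)
From HB Require Import structures.
From mathcomp Require Import all_boot all_order all_fingroup all_algebra.
From mathcomp Require Import boolp.

Set Implicit Arguments.
Unset Strict Implicit.
Unset Printing Implicit Defensive.

Import GRing.Theory.
Local Open Scope ring_scope.

(* R being finite, its ideals are elements of {set R}; [idealr_closed] is the
   library's notion of a proper ideal (it includes 1 \notin I). *)
Definition maximal_ideal (R : finComNzRingType) (M : {set R}) : Prop :=
  idealr_closed M /\
  forall I : {set R}, idealr_closed I -> M \subset I -> I = M.

Definition local_ring (R : finComNzRingType) : Prop :=
  exists! M : {set R}, maximal_ideal M.

(* R[x] / (x^2).  The library quotient {poly %/ h} is the intended one when h
   is monic of degree at least 1, which holds for 'X^2. *)
Definition dual_numbers (R : finComNzRingType) : predArgType :=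
  {poly %/ ('X^2 : {poly R})}.

HB.instance Definition _ (R : finComNzRingType) :=
  GRing.ComNzRing.on (dual_numbers R).
HB.instance Definition _ (R : finComNzRingType) :=
  Finite.on (dual_numbers R).

Definition dual_const (R : finComNzRingType) (a : R) : dual_numbers R :=
  qpolyC 'X^2 a.

Definition dual_alpha (R : finComNzRingType) : dual_numbers R :=
  in_qpoly 'X^2 'X.

Lemma dual_alpha_sqr (R : finComNzRingType) :
  dual_alpha R * dual_alpha R = 0.
Proof.
rewrite /dual_alpha -(in_qpolyM ('X^2 : {poly R})) -expr2; apply: val_inj.
by rewrite /= mk_monic_Xn Pdiv.RingMonic.rmodpp ?monicXn.
Qed.

Lemma dual_numbers_eq (R : finComNzRingType) (z : dual_numbers R) :
  exists! ab : R * R, z = dual_const ab.1 + dual_const ab.2 * dual_alpha R.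
Proof.
have E (a b : R) : polyn (dual_const a + dual_const b * dual_alpha R)
    = a%:P + b *: 'X.
  rewrite /dual_const /dual_alpha /= mk_monic_Xn.
  have s2 : (size ('X : {poly R}) < size ('X^2 : {poly R}))%N.
    by rewrite size_polyX size_polyXn.
  rewrite (Pdiv.CommonRing.rmodp_small s2) mul_polyC.
  by rewrite Pdiv.CommonRing.rmodp_small // (leq_ltn_trans (size_scale_leq _ _)).
exists ((polyn z)`_0, (polyn z)`_1); split=> [|[a b] ->].
  apply: val_inj; rewrite [RHS]E /=; apply/polyP=> i.
  rewrite coefD coefC coefZ coefX.
  case: i => [|[|i]] /=; rewrite ?mulr0 ?mulr1 ?addr0 ?add0r //.
  rewrite nth_default // (leq_trans (size_npoly z)) //.
  by rewrite mk_monic_Xn size_polyXn.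
by rewrite !E !coefD !coefC !coefZ !coefX /= !mulr0 addr0 add0r mulr1.
Qed.

Definition poly_funs (A : finComNzRingType) : {set {ffun A -> A}} :=
  [set F : {ffun A -> A} | `[< exists f : {poly A}, forall a, F a = f.[a] >]].

Definition poly_perms (A : finComNzRingType) : {set {ffun A -> A}} :=
  [set F in poly_funs A | `[< bijective F >]].

Definition dual_stab (R : finComNzRingType) :
    {set {ffun dual_numbers R -> dual_numbers R}} :=
  [set F in poly_perms (dual_numbers R) |
    [forall a : R, F (dual_const a) == dual_const a]].

(* Main.v *)
Require Import Defs.
From HB Require Import structures.
From mathcomp Require Import all_boot all_order all_fingroup all_algebra.
From mathcomp Require Import boolp ring.

(** Writing a polynomial over R[alpha] as f = f1 + f2 alpha with f1, f2 over R,
  f (a + b alpha) = f1 a + (b f1' a + f2 a) alpha.  Hence restricting to R sends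
  a permutation F of R[alpha] to the pair of functions (f2, f1), with f1 a
  permutation of R.  The fibres of this map are the cosets F o St_alpha(R), so
  only surjectivity is left: every permutation f1 of R has to be induced by a
  polynomial whose derivative takes unit values.  When R is a field, add a
  suitable multiple of prod_a (X - a) to f1.  Otherwise this holds for every
  polynomial: choose s <> 0 killed by all non-units; if f1' a is not a unit
  then f1 (a + s) = f1 a. *)

Set Implicit Arguments.
Unset Strict Implicit.
Unset Printing Implicit Defensive.

Import GRing.Theory.
Local Open Scope ring_scope.

Definition invertible (A : comNzRingType) (x : A) : Prop :=
  exists y, x * y = 1.

Lemma invertible_prod (A : comNzRingType) (I : Type) (s : seq I) (P : pred I)
    (F : I -> A) :
  (forall i, P i -> invertible (F i)) -> invertible (\prod_(i <- s | P i) F i).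
Proof.
move=> HF; apply: (big_ind (@invertible A)) => //.
  by exists 1; rewrite mulr1.
move=> x y [x' Hx] [y' Hy]; exists (x' * y').
by rewrite mulrACA Hx Hy mulr1.
Qed.

(** First-order Taylor expansion: the higher terms carry a factor s^2. It serves both for s = b
    alpha in R[alpha] and for an element s of R that all non-units kill. *)
Lemma horner_addr (A : comNzRingType) (f : {poly A}) (a s : A) :
  s * s = 0 -> f.[a + s] = f.[a] + f^`().[a] * s.
Proof.
move=> ss0; elim/poly_ind: f => [|p c IH].
  by rewrite deriv0 !horner0; ring.
by rewrite derivMXaddC !hornerE IH; ring: ss0.
Qed.

(** * Polynomial functions and permutations of a finite ring *)

Section PolynomialFunctions.

Variable A : finComNzRingType.

Lemma poly_funsP (F : {ffun A -> A}) :
  reflect (exists f : {poly A}, forall a, F a = f.[a]) (F \in poly_funs A).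
Proof. by rewrite inE; apply: asboolP. Qed.

Lemma poly_permsP (F : {ffun A -> A}) :
  reflect (F \in poly_funs A /\ injective F) (F \in poly_perms A).
Proof.
rewrite [F \in poly_perms A]in_set; apply: (iffP andP) => -[HF].
  by move=> /asboolP/bij_inj; split.
by move=> injF; split=> //; apply/asboolP/injF_bij.
Qed.

Lemma poly_funs_horner (f : {poly A}) : [ffun a => f.[a]] \in poly_funs A.
Proof. by apply/poly_funsP; exists f => a; rewrite ffunE. Qed.

Lemma poly_perms_comp (F G : {ffun A -> A}) :
  F \in poly_perms A -> G \in poly_perms A ->
  [ffun a => F (G a)] \in poly_perms A.
Proof.
move=> /poly_permsP[/poly_funsP[f Hf] injF].
move=> /poly_permsP[/poly_funsP[g Hg] injG].
apply/poly_permsP; split.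
  by apply/poly_funsP; exists (f \Po g) => a; rewrite ffunE horner_comp Hf Hg.
by move=> a b; rewrite !ffunE => /injF/injG.
Qed.

(* Composition with F is injective on the finite set of permutations, hence
   onto; this avoids exhibiting a polynomial for the inverse of F. *)
Lemma poly_perms_div (F G : {ffun A -> A}) :
  F \in poly_perms A -> G \in poly_perms A ->
  exists2 S, S \in poly_perms A & G = [ffun a => F (S a)].
Proof.
move=> HF HG; pose c (S : {ffun A -> A}) := [ffun a => F (S a)].
have injc : injective c.
  move=> S T /ffunP eqST; apply/ffunP => a.
  have /poly_permsP[_ injF] := HF.
  by apply: injF; have := eqST a; rewrite !ffunE.
have sub : c @: poly_perms A \subset poly_perms A.
  by apply/subsetP=> _ /imsetP[S HS ->]; apply: poly_perms_comp.
have /eqP eqc : c @: poly_perms A == poly_perms A.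
  by rewrite eqEcard sub card_imset /=.
by have /imsetP[S HS ->] : G \in c @: poly_perms A; [rewrite eqc | exists S].
Qed.

End PolynomialFunctions.

(** * Finite local rings and derivatives of permutation polynomials *)

Section LocalRing.

Variables (R : finComNzRingType) (hR : local_ring R).

Lemma principal_ideal (x : R) :
  ~ invertible x -> idealr_closed [set x * r | r : R].
Proof.
move=> xN; split.
- by apply/imsetP; exists 0; rewrite ?mulr0.
- by apply/imsetP=> -[r _ e]; apply: xN; exists r.
- move=> a u v /imsetP[r _ ->] /imsetP[t _ ->]; apply/imsetP.
  by exists (a * r + t) => //; ring.
Qed.

Lemma sub_maximal_ideal (I : {set R}) :
  idealr_closed I -> exists2 M, maximal_ideal M & I \subset M.
Proof.
move=> /asboolP HI.
have [M /maxsetP[/asboolP HM maxM] IM] :=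
  maxset_exists (P := fun J : {set R} => `[< idealr_closed J >]) HI.
by exists M => //; split=> // J /asboolP HJ; apply: maxM.
Qed.

(** If x and 1 - x were both non-units, both would lie in the unique maximal ideal, and so would
    their sum 1. *)
Lemma local_invertible (x : R) : ~ invertible x -> invertible (1 - x).
Proof.
move=> xN; apply: contrapT => yN.
have [M0 [_ uniqM]] := hR.
have inM z : ~ invertible z -> z \in M0.
  move=> /principal_ideal/sub_maximal_ideal[M /uniqM -> /subsetP]; apply.
  by apply/imsetP; exists 1; rewrite ?mulr1.
have [M /[dup] /uniqM eqM [[_ M1 MI] _] _] :=
  sub_maximal_ideal (principal_ideal xN).
move: M1; rewrite -eqM => /negP; apply.
by rewrite -(subrK x 1) -[1 - x]mul1r; move: MI; rewrite -eqM;
  apply; apply: inM.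
Qed.

(** Take s among the nonzero non-units with sR of least cardinality. If s m <> 0 for a non-unit m,
    then smR = sR by minimality, so s = s m r for some r; as 1 - m r is a unit, s = 0. *)
Lemma socle_element :
  (exists2 x : R, x != 0 & ~ invertible x) ->
  exists s : R,
    [/\ s != 0, ~ invertible s & forall m, ~ invertible m -> s * m = 0].
Proof.
case=> x0 x0N0 /asboolPn x0N.
pose P (s : R) := (s != 0) && ~~ `[< invertible s >].
have Px0 : P x0 by rewrite /P x0N0.
case: (arg_minnP (fun s : R => #|[set s * r | r : R]|) Px0)
  => s /andP[s0 sN] smin.
exists s; split=> // [|m mN]; first exact/asboolPn.
apply/eqP; apply: contraT => sm0.
have smP : P (s * m).
  rewrite /P sm0 /=; apply/asboolPn => -[y e]; apply: mN.
  by exists (s * y); rewrite -e; ring.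
have sub : [set s * m * r | r : R] \subset [set s * r | r : R].
  by apply/subsetP=> _ /imsetP[r _ ->]; apply/imsetP;
     exists (m * r); rewrite ?mulrA.
have /eqP eqI : [set s * m * r | r : R] == [set s * r | r : R].
  by rewrite eqEcard sub smin.
have : s \in [set s * r | r : R] by apply/imsetP; exists 1; rewrite ?mulr1.
rewrite -eqI => /imsetP[r _ es].
have mrN : ~ invertible (m * r).
  by case=> y e; apply: mN; exists (r * y); rewrite mulrA.
have [y ey] := local_invertible mrN.
have s00 : s = 0.
  have sz : s * (1 - m * r) = 0 by rewrite mulrBr mulr1 mulrA -es subrr.
  by rewrite -[s]mulr1 -ey mulrA sz mul0r.
by rewrite s00 eqxx in s0.
Qed.

Lemma poly_perms_invertible_deriv (F : {ffun R -> R}) :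
  F \in poly_perms R ->
  exists2 f : {poly R}, forall a, F a = f.[a] & forall a, invertible f^`().[a].
Proof.
move=> /poly_permsP[/poly_funsP[f Ff] injF].
have [/socle_element[s [s0 sI sN]]|fieldR] :=
    pselect (exists2 x : R, x != 0 & ~ invertible x).
  exists f => // a; apply: contrapT => /sN sf0.
  (* Since s is itself a non-unit, it kills itself, and the first-order expansion at a + s is
     exact. *)
  have ss0 : s * s = 0 by apply: sN.
  have /injF : F (a + s) = F a by rewrite !Ff horner_addr // mulrC sf0 addr0.
  by move/eqP; rewrite -subr_eq0 addrC addKr (negPf s0).
have inv_neq0 (x : R) : x != 0 -> invertible x.
  by move=> x0; apply: contrapT => xN; apply: fieldR; exists x.
(* Here R is a field. The value of [q a] at a is that of the derivative of prod_b (X - b) at a;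
   [u a] is its inverse. *)
pose q (a : R) : {poly R} := \prod_(b | b != a) ('X - b%:P).
have nodalE a : \prod_b ('X - b%:P) = ('X - a%:P) * q a by rewrite (bigD1 a).
have qN a b : a != b -> (q b).[a] = 0.
  by move=> ab; rewrite /q (bigD1 a) //= hornerM hornerXsubC subrr mul0r.
have /choice[u uP] (a : R) : invertible (q a).[a].
  rewrite /q horner_prod; apply: invertible_prod => b ba.
  by apply: inv_neq0; rewrite hornerXsubC subr_eq0 eq_sym.
(* Lagrange interpolation: one factor [u b] normalizes [q b] to 1 at b, the other cancels the factor
   [(q b).[b]] that differentiating the product prod_b (X - b) * h brings in. *)
pose h : {poly R} := \sum_b ((1 - f^`().[b]) * u b * u b)%:P * q b.
have hE a : h.[a] = (1 - f^`().[a]) * u a.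
  rewrite /h horner_sum (bigD1 a) //= big1 ?addr0.
    by rewrite hornerCM; ring: (uP a).
  by move=> b ba; rewrite hornerCM qN ?mulr0 // eq_sym.
exists (f + \prod_b ('X - b%:P) * h) => a.
  by rewrite Ff (nodalE a) !hornerE subrr !mul0r addr0.
(* The corrected polynomial has derivative f'(a) + (1 - f'(a)) = 1 at every a. *)
exists 1; rewrite (nodalE a) derivD !derivM derivXsubC mul1r.
rewrite !(hornerD, hornerM) hE hornerX hornerN hornerC subrr.
by ring: (uP a).
Qed.

End LocalRing.

(** * Polynomial functions on the dual numbers and their restriction to R *)

HB.instance Definition _ (R : finComNzRingType) :=
  GRing.isZmodMorphism.Build R (dual_numbers R) (@dual_const R)
    (@qpolyC_is_zmod_morphism R 'X^2).
HB.instance Definition _ (R : finComNzRingType) :=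
  GRing.isMonoidMorphism.Build R (dual_numbers R) (@dual_const R)
    (@qpolyC_is_monoid_morphism R 'X^2).

Section DualNumbers.

Variable R : finComNzRingType.
Implicit Types (F G S : {ffun dual_numbers R -> dual_numbers R}) (a b : R).

Definition dual (a b : R) : dual_numbers R :=
  dual_const a + dual_const b * dual_alpha R.

Lemma dualP (z : dual_numbers R) : exists ab : R * R, z = dual ab.1 ab.2.
Proof. by have [ab [-> _]] := dual_numbers_eq z; exists ab. Qed.

Lemma dual_inj a b a' b' : dual a b = dual a' b' -> a = a' /\ b = b'.
Proof.
move=> e; have [ab [_ uniq_ab]] := dual_numbers_eq (dual a b).
by move: (uniq_ab (a, b) erefl); rewrite (uniq_ab (a', b') e) => -[-> ->].
Qed.

Lemma dual0 a : dual a 0 = dual_const a.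
Proof. by rewrite /dual [dual_const 0]rmorph0 mul0r addr0. Qed.

Lemma horner_map_dual (f : {poly R}) a b :
  (map_poly (@dual_const R) f).[dual a b] = dual f.[a] (b * f^`().[a]).
Proof.
rewrite /dual horner_addr; last first.
  by rewrite mulrACA dual_alpha_sqr mulr0.
rewrite deriv_map !horner_map rmorphM /=. by ring.
Qed.

Lemma horner_dual (f1 f2 : {poly R}) a b :
  (map_poly (@dual_const R) f1 + dual_alpha R *:
      map_poly (@dual_const R) f2).[dual a b]
    = dual f1.[a] (b * f1^`().[a] + f2.[a]).
Proof.
rewrite hornerD hornerZ !horner_map_dual /dual !rmorphD.
by ring: (dual_alpha_sqr R).
Qed.

Lemma poly_dualP (f : {poly dual_numbers R}) : exists f1 f2 : {poly R},
  f = map_poly (@dual_const R) f1 + dual_alpha R *: map_poly (@dual_const R) f2.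
Proof.
elim/poly_ind: f => [|p c [p1 [p2 ->]]].
  by exists 0, 0; rewrite rmorph0 scaler0 addr0.
have [[c1 c2] ->] := dualP c.
exists (p1 * 'X + c1%:P), (p2 * 'X + c2%:P).
rewrite !rmorphD !rmorphM /= !map_polyX !map_polyC /= /dual.
rewrite -!mul_polyC; ring.
Qed.

Lemma poly_funs_dual F : F \in poly_funs (dual_numbers R) ->
  exists f1 f2 : {poly R},
    forall a b, F (dual a b) = dual f1.[a] (b * f1^`().[a] + f2.[a]).
Proof.
move=> /poly_funsP[f Ff]; have [f1 [f2 fE]] := poly_dualP f.
by exists f1, f2 => a b; rewrite Ff fE horner_dual.
Qed.

Definition dual_coords (z : dual_numbers R) : R * R := sval (cid (dualP z)).

Lemma dual_coordsK z : dual (dual_coords z).1 (dual_coords z).2 = z.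
Proof. by rewrite /dual_coords; case: cid. Qed.

Lemma dualK a b : dual_coords (dual a b) = (a, b).
Proof.
by have /dual_inj[] := dual_coordsK (dual a b);
  case: dual_coords => c d /= -> ->.
Qed.

(** The alpha coordinate comes first, so that the pair lands in
    [setX (poly_funs R) (poly_perms R)]. *)
Definition dual_restr F : {ffun R -> R} * {ffun R -> R} :=
  ([ffun a => (dual_coords (F (dual_const a))).2],
   [ffun a => (dual_coords (F (dual_const a))).1]).

Lemma dual_restr_eq F G :
  dual_restr F = dual_restr G <-> forall a, F (dual_const a) = G (dual_const a).
Proof.
split=> [[/ffunP e2 /ffunP e1] a|e].
  move: (e1 a) (e2 a); rewrite !ffunE => E1 E2.
  by rewrite -[LHS]dual_coordsK E1 E2 dual_coordsK.
by congr pair; apply/ffunP=> a; rewrite !ffunE e.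
Qed.

Lemma dual_restr_in F : F \in poly_perms (dual_numbers R) ->
  dual_restr F \in setX (poly_funs R) (poly_perms R).
Proof.
move=> /poly_permsP[/poly_funs_dual[f1 [f2 FE]] injF].
have -> : dual_restr F = ([ffun a => f2.[a]], [ffun a => f1.[a]]).
  by congr pair; apply/ffunP=> a; rewrite !ffunE -dual0 FE dualK //=
    mul0r add0r.
rewrite in_setX /= poly_funs_horner; apply/poly_permsP; split.
  exact: poly_funs_horner.
have [F' _ F'K] := injF_bij injF.
(* The constant coordinate of an F-preimage of b is an f1-preimage of b. A section g of f1 is
   injective, hence bijective by finiteness, so f1 is its inverse. *)
have surj b : exists a, f1.[a] = b.
  have [[a c] e] := dualP (F' (dual_const b)); exists a.
  by have := F'K (dual_const b); rewrite e FE -dual0 => /dual_inj[].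
have [g gK] := choice surj.
have /injF_bij[g' g'K gK'] : injective g by apply: can_inj gK.
by move=> a b; rewrite !ffunE -[a]gK' -[b]gK' !gK => ->.
Qed.

Lemma dual_restr_onto (hR : local_ring R) (FF : {ffun R -> R} * {ffun R -> R}) :
  FF \in setX (poly_funs R) (poly_perms R) ->
  exists2 F, F \in poly_perms (dual_numbers R) & dual_restr F = FF.
Proof.
case: FF => F2 F1 /setXP[/poly_funsP[f2 E2] HF1].
have [f1 E1 unit_f1'] := poly_perms_invertible_deriv hR HF1.
have /poly_permsP[_ injF1] := HF1.
pose f := map_poly (@dual_const R) f1 +
  dual_alpha R *: map_poly (@dual_const R) f2.
exists [ffun z => f.[z]].
  apply/poly_permsP; split; first exact: poly_funs_horner.
  move=> z z'; rewrite !ffunE.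
  have [[a b] ->] := dualP z; have [[a' b'] ->] /= := dualP z'.
  (* The constant coordinates give a = a'; then f2 a cancels, and b = b' because f1' a is a unit. *)
  rewrite !horner_dual => /dual_inj[]; rewrite -!E1 => /injF1 <-.
  move=> /addIr eb; have [v f1v] := unit_f1' a.
  by rewrite -[b]mulr1 -[b']mulr1 -f1v !mulrA eb.
congr pair; apply/ffunP=> a;
  by rewrite !ffunE -dual0 horner_dual dualK /= ?mul0r ?add0r.
Qed.

(** Composition S -> G o S is injective, and its image of the stabilizer is the whole fibre: every F
    is some G o S, and it agrees with G on R exactly when S fixes R pointwise, G being injective. *)
Lemma card_dual_restr_fiber G : G \in poly_perms (dual_numbers R) ->
  #|[set F in poly_perms (dual_numbers R) | dual_restr F == dual_restr G]|
    = #|dual_stab R|.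
Proof.
move=> HG; have /poly_permsP[_ injG] := HG.
pose c (S : {ffun dual_numbers R -> dual_numbers R}) := [ffun z => G (S z)].
have injc : injective c.
  move=> S T /ffunP eqST; apply/ffunP=> z.
  by apply: injG; have := eqST z; rewrite !ffunE.
rewrite -[RHS](card_imset _ injc); apply: eq_card => F; rewrite [LHS]in_set.
apply/andP/imsetP => [[HF /eqP/dual_restr_eq FG]|[S]].
  have [S HS FE] := poly_perms_div HG HF; exists S => //.
  rewrite inE HS; apply/forallP=> a; apply/eqP/injG.
  by have := FG a; rewrite FE ffunE.
rewrite [S \in _]in_set => /andP[HS /forallP fixS] ->; split.
  exact: poly_perms_comp.
by apply/eqP/dual_restr_eq => a; rewrite ffunE (eqP (fixS a)).
Qed.

End DualNumbers.

Theorem theorem5p7 (R : finComNzRingType) (hR : local_ring R) :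
  (#|poly_perms (dual_numbers R)| =
   #|poly_funs R| * #|poly_perms R| * #|dual_stab R|)%N.
Proof.
rewrite -cardsX -sum1_card.
(* Count the permutations fibre by fibre; surjectivity supplies in each fibre a G to compare with
   the stabilizer. *)
rewrite (partition_big (@dual_restr R)
    (mem (setX (poly_funs R) (poly_perms R))));
  last exact: dual_restr_in.
rewrite -sum_nat_const; apply: eq_bigr => FF /(dual_restr_onto hR)[G HG <-].
rewrite -(card_dual_restr_fiber HG) -sum1_card.
by apply: eq_bigl => F; rewrite inE.
Qed.
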